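(* There exist absolute constants $c,c'>0$ such that for all integers $n\ge r\ge 2$ with $\sqrt n\le r\le c'\,\frac{n}{\ln n}$, $$p(n,r)\ge c\,\frac{r}{n}\,e^{\frac{n}{r}} .$$
   Context: A hypergraph is a pair $(V,E)$ where $V$ is a finite set (of vertices) and $E$ is a family of subsets of $V$ (edges). It is $n$-uniform if every edge has size $n$. A vertex $r$-coloring is a map $V\to\{1,\dots,r\}$; it is called panchromatic if every edge contains a vertex of every one of the $r$ colors. $p(n,r)$ denotes the minimal number of edges of an $n$-uniform hypergraph that has no panchromatic $r$-coloring. *)

(* Defs.v *)
From mathcomp Require Import all_boot all_order all_algebra.
From mathcomp Require Import all_classical all_reals all_analysis.

Set Implicit Arguments.
Unset Strict Implicit.
Unset Printing Implicit Defensive.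

Record hypergraph := Hypergraph {
  vertex :> finType;
  edges : {set {set vertex}}
}.

Definition uniform (n : nat) (H : hypergraph) : Prop :=
  forall e : {set H}, e \in edges H -> #|e| = n.

Definition panchromatic (H : hypergraph) (r : nat) (f : H -> 'I_r) : Prop :=
  forall e : {set H}, e \in edges H ->
    forall i : 'I_r, exists2 v : H, v \in e & f v = i.

Definition not_panchromatic_size (n r m : nat) : Prop :=
  exists H : hypergraph,
    [/\ uniform n H,
        ~ (exists f : H -> 'I_r, panchromatic f)
      & #|edges H| = m].

(* The value 0 is only a default for the case where no n-uniform hypergraph
   without panchromatic r-coloring exists; by [not_panchromatic_size_ex] this
   does not happen when r >= 2. *)
Definition p (n r : nat) : nat :=
  match pselect (exists m, `[< not_panchromatic_size n r m >]) with
  | left ex => ex_minn ex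
  | right _ => 0
  end.

Lemma not_panchromatic_size_ex (n r : nat) :
  1 < r -> exists m, not_panchromatic_size n r m.
Proof.
move=> r_gt1.
pose H := @Hypergraph 'I_(n + n) [set e : {set 'I_(n + n)} | #|e| == n].
exists #|edges H|; exists H; split=> //.
  by move=> e; rewrite inE => /eqP.
case=> f fP.
pose i0 := Ordinal (ltnW r_gt1); pose i1 := Ordinal r_gt1.
pose A : {set H} := [set v | f v == i0].
have sub_mono (B : {set H}) (i : 'I_r) :
    n <= #|B| -> (forall v, v \in B -> f v <> i) -> False.
  move=> /card_geqP[s [s_uniq s_size sB]] Bi.
  have sE : [set x in s] \in edges H.
    by rewrite inE cardsE (card_uniqP s_uniq) s_size.
  have [v] := fP _ sE i; rewrite inE => /sB; exact: Bi.
have [leA|ltA] := leqP n #|A|.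
  by apply: (sub_mono A i1 leA) => v; rewrite inE => /eqP ->.
apply: (sub_mono (~: A) i0) => [|v]; last by rewrite !inE => /eqP.
rewrite -(leq_add2l #|A|) cardsC card_ord leq_add2r; exact: ltnW.
Qed.

Lemma p_attained (n r : nat) : 1 < r -> not_panchromatic_size n r (p n r).
Proof.
move=> /(not_panchromatic_size_ex n)[m mP]; rewrite /p.
case: pselect => [ex|[]]; last by exists m; apply/asboolP.
by case: ex_minnP => k /asboolP.
Qed.

Lemma p_minimal (n r m : nat) : not_panchromatic_size n r m -> p n r <= m.
Proof.
move=> mP; rewrite /p; case: pselect => [ex|//].
by case: ex_minnP => k _; apply; apply/asboolP.
Qed.

(* Main.v *)
Require Import Defs.
From mathcomp Require Import all_boot all_order all_algebra.
From mathcomp Require Import all_classical all_reals all_analysis.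
From mathcomp Require Import ring lra fintype finset.
Set Implicit Arguments.
Unset Strict Implicit.
Unset Printing Implicit Defensive.
Import Order.TTheory GRing.Theory Num.Theory.
Local Open Scope ring_scope.

(** Suppose that an n-uniform hypergraph has fewer than c (r/n) e^(n/r) edges,
where c = e^(-2)/2. A panchromatic coloring is built in two rounds.

Color the vertices uniformly at random. For an edge e and a color j let S(e,j)
be the set of vertices of color j in e, and put
  Phi = sum over (e,j) of (2r/n)^|S(e,j)|.
The mean of x^|S(e,j)| is (1 - 1/r + x/r)^n, so the mean of Phi is at most
|E| r e^(2 - n/r), and some coloring f has Phi <= r^2/(2n). This one bound
controls both the number of pairs (e,j) with S(e,j) empty and the number of
pairs for which S(e,j) is small but not empty
([exists_coloring_small_potential]).

Each of the M pairs (e,j) with S(e,j) empty demands a vertex of e to be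
recolored with j. This repairs the coloring if the chosen vertices are distinct
and no nonempty S(e,j) consists of chosen vertices only. Such a choice exists
by the counting form of the Lovasz local lemma: when one more demand is served,
at least half of the n candidate vertices, on average over the admissible
choices made for the others, keep the choice admissible
([admissible_growth]). With y = r/n, the candidates lost number on average at
most
  M + sum of |S(e,j)| y^(|S(e,j)|-1) over the nonempty S(e,j),
because a given set of k vertices is covered by the earlier choices with
frequency at most (2M/n)^k ([card_covering]) and 2M/n <= y.
Since k y^(k-1) <= (2y)^k / y, this loss is at most (n/r) Phi <= r/2 <= n/2. *)

(** * Choosing representatives that cover no forbidden set *)

Section Counting.
Variables (R : realFieldType) (B V I : finType).
Variables (e : B -> {set V}) (J : {set I}) (S : I -> {set V}).
Implicit Types (g : {ffun B -> option V}) (A : {set B}) (T : {set V}) (a b : B) (v s : V) (i : I).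

Definition image_of (g : {ffun B -> option V}) : {set V} :=
  [set v | [exists b, g b == Some v]].

(** A partial choice of representatives is a function with values in
[option V]. It has to be defined exactly on [A]: then removing one demand from
an admissible choice on [A] gives an admissible choice on [A :\ a], and the
counts for different [A] can be compared. *)
Definition admissible (A : {set B}) : {set {ffun B -> option V}} :=
  [set g : {ffun B -> option V} |
    [&& [forall b, (b \in A) == (g b != None)],
        [forall b, forall v, (g b == Some v) ==> (v \in e b)],
        [forall a, forall b, (g a != None) && (g a == g b) ==> (a == b)]
      & [forall i in J, ~~ (S i \subset image_of g)]]].

Definition assign (g : {ffun B -> option V}) (b : B) (o : option V) :=
  [ffun a => if a == b then o else g a].

Lemma admissibleP (A : {set B}) (g : {ffun B -> option V}) :
  reflect [/\ forall b, (b \in A) = (g b != None),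
              forall b v, g b = Some v -> v \in e b,
              forall a b, g a != None -> g a = g b -> a = b
            & forall i, i \in J -> ~~ (S i \subset image_of g)]
          (g \in admissible A).
Proof.
rewrite inE; apply: (iffP and4P) => -[h1 h2 h3 h4]; split.
- by move=> b; apply/eqP/(forallP h1).
- by move=> b v gb; move/forallP/(_ b)/forallP/(_ v)/implyP: h2; apply; apply/eqP.
- move=> a b ga gab; move/forallP/(_ a)/forallP/(_ b)/implyP: h3 => h3.
  by apply/eqP/h3; rewrite ga gab eqxx.
- by move=> i iJ; move/forallP/(_ i)/implyP: h4; apply.
- by apply/forallP => b; apply/eqP.
- by apply/forallP => b; apply/forallP => v; apply/implyP => /eqP; apply: h2.
- apply/forallP => a; apply/forallP => b; apply/implyP => /andP[ga /eqP gab].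
  exact/eqP/h3.
- by apply/forallP => i; apply/implyP; apply: h4.
Qed.

Lemma image_ofP g v : reflect (exists b, g b = Some v) (v \in image_of g).
Proof.
rewrite inE; apply: (iffP existsP) => -[b /eqP gb]; exists b => //; exact/eqP.
Qed.

Lemma image_of_unassign g a : {subset image_of (assign g a None) <= image_of g}.
Proof.
move=> v /image_ofP[b]; rewrite ffunE; case: eqP => // _ gb.
by apply/image_ofP; exists b.
Qed.

Lemma assignK g a o : g a = o -> assign (assign g a None) a o = g.
Proof. by move=> ga; apply/ffunP => b; rewrite !ffunE; case: eqP => // ->. Qed.

Lemma admissible_unassign A g a :
  g \in admissible A -> assign g a None \in admissible (A :\ a).
Proof.
move=> /admissibleP[h1 h2 h3 h4]; apply/admissibleP; split.
- by move=> b; rewrite !inE ffunE h1; case: eqP.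
- by move=> b v; rewrite ffunE; case: eqP => // _; apply: h2.
- move=> b c; rewrite !ffunE; case: (b =P a) => // _; case: (c =P a) => _.
    by move=> + gb; rewrite gb.
  exact: h3.
- move=> i iJ; apply: contra (h4 i iJ) => /subsetP sub.
  by apply/subsetP => v /sub; apply: image_of_unassign.
Qed.

Definition covering (A : {set B}) (T : {set V}) :=
  [set g in admissible A | T \subset image_of g].

(** Forgetting the value at [a] loses no information when that value is known
to be [s], and the rest of [T] stays covered by the other demands. *)
Lemma card_covering_value A T a s : s \in T ->
  (#|[set g in covering A T | g a == Some s]| <= #|covering (A :\ a) (T :\ s)|)%N.
Proof.
move=> sT.
rewrite -(card_in_imset (f := fun g => assign g a None)); last first.
  move=> g g'; rewrite !inE => /andP[_ /eqP ga] /andP[_ /eqP ga'] eqg.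
  by rewrite -(assignK ga) -(assignK ga') eqg.
apply/subset_leq_card/subsetP => _ /imsetP[g + ->].
rewrite inE inE => /andP[/andP[gA /subsetP sub] /eqP ga].
rewrite inE admissible_unassign //=; apply/subsetP => v; rewrite !inE.
case/andP=> vs /sub /image_ofP[b gb]; apply/existsP; exists b; rewrite ffunE.
case: (b =P a) => [eba|_]; last exact/eqP.
by move: gb; rewrite eba ga => -[sv]; rewrite sv eqxx in vs.
Qed.

Lemma card_covering_le A T s : s \in T ->
  (#|covering A T| <= \sum_(a in A) #|covering (A :\ a) (T :\ s)|)%N.
Proof.
move=> sT.
apply: (@leq_trans (\sum_(a in A) #|[set g in covering A T | g a == Some s]|)).
  have sub : covering A T
      \subset \bigcup_(a in A) [set g in covering A T | g a == Some s].
    apply/subsetP => g gAT; apply/bigcupP.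
    move: (gAT); rewrite inE => /andP[/admissibleP[h1 _ _ _] /subsetP/(_ s sT)].
    case/image_ofP => a ga; exists a; first by rewrite h1 ga.
    by rewrite inE gAT ga eqxx.
  apply: leq_trans (subset_leq_card sub) _.
  elim/big_rec2: _ => [|a n X _ le]; first by rewrite cards0.
  by rewrite (leq_trans (leq_card_setU _ _).1) // leq_add2l.
by apply: leq_sum => a _; apply: card_covering_value.
Qed.

Variables (n : nat) (y : R) (D : {set B}).
Hypothesis n_gt0 : (0 < n)%N.
Hypothesis card_e : forall b, b \in D -> #|e b| = n.
Hypothesis y_ge0 : 0 <= y.
Hypothesis le_Dy : #|D|%:R <= y * (n%:R / 2).

(** The proportion of admissible choices that cover [T] is at most what it would
be if each vertex were chosen independently with probability [y]. The element
[s] of [T] is the representative of one of at most [y n / 2] demands; freeing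
that demand costs a factor [2 / n] in the number of admissible choices and
leaves [T :\ s] to be covered. The growth of the counts is a hypothesis since
its proof uses this bound for smaller sets of demands. *)
Lemma card_covering A T : A \subset D ->
  (forall A' b, A' \subset A -> b \in A' ->
     n%:R / 2 * #|admissible (A' :\ b)|%:R <= #|admissible A'|%:R :> R) ->
  #|covering A T|%:R <= y ^+ #|T| * #|admissible A|%:R :> R.
Proof.
elim: {T}_.+1 {-2}T A (ltnSn #|T|) => // k IH T A leT AD hA.
have [->|[s sT]] := set_0Vmem T.
  rewrite cards0 expr0 mul1r ler_nat; apply/subset_leq_card/subsetP => g.
  by rewrite inE => /andP[].
have cT : #|T| = #|T :\ s|.+1 by rewrite (cardsD1 s T) sT.
rewrite cT ltnS in leT *.
apply: le_trans (_ : \sum_(a in A) y ^+ #|T :\ s| * #|admissible (A :\ a)|%:R <= _).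
  apply: le_trans (_ : (\sum_(a in A) #|covering (A :\ a) (T :\ s)|)%:R <= _).
    by rewrite ler_nat card_covering_le.
  rewrite natr_sum; apply: ler_sum => a aA; apply: IH => //.
    exact: subset_trans (subsetDl _ _) AD.
  move=> A' b A'A; apply: hA; exact: subset_trans A'A (subsetDl _ _).
rewrite -mulr_sumr exprSr -mulrA ler_wpM2l ?exprn_ge0 //.
have n2 : 0 < n%:R / 2 :> R by rewrite divr_gt0 ?ltr0n.
rewrite -(ler_pM2l n2) mulr_sumr.
apply: le_trans (_ : \sum_(a in A) #|admissible A|%:R <= _).
  by apply: ler_sum => a aA; apply: hA.
rewrite sumr_const -[leLHS]mulr_natl mulrA ler_wpM2r ?ler0n //.
rewrite mulrC; apply: le_trans le_Dy; rewrite ler_nat; exact: subset_leq_card.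
Qed.

Hypothesis budget :
  \sum_(i in J) #|S i|%:R * y ^+ #|S i|.-1 + #|D|%:R <= n%:R / 2.

Lemma card_image_of A g : g \in admissible A -> (#|image_of g| <= #|A|)%N.
Proof.
move=> /admissibleP[h1 _ _ _].
apply: (@leq_trans #|[set g b | b in A]|); last exact: leq_imset_card.
have Some_inj : injective (@Some V) by move=> u v [].
rewrite -(card_imset _ Some_inj); apply/subset_leq_card/subsetP => o.
case/imsetP => v /image_ofP[b gb] ->; apply/imsetP; exists b => //.
by rewrite h1 gb.
Qed.

(** An admissible choice [g] on [A :\ b] and a vertex [v] of [e b] can fail to
combine for two reasons only: [v] is already taken by [g], or [v] completes the
covering of some forbidden [S i]. *)
Lemma admissible_extend A b : A \subset D -> b \in A ->
  (n * #|admissible (A :\ b)| <= #|admissible A| + #|A| * #|admissible (A :\ b)|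
     + \sum_(i in J) \sum_(v in S i) #|covering (A :\ b) (S i :\ v)|)%N.
Proof.
move=> AD bA; set A0 := A :\ b.
pose G := admissible A0.
rewrite -(card_e (subsetP AD b bA)) mulnC -cardsX.
(* X0: the extension succeeds; X1: v is taken; X2: v completes some S i. *)
pose X0 := [set p in setX G (e b) | assign p.1 b (Some p.2) \in admissible A].
pose X1 := [set p in setX G (e b) | p.2 \in image_of p.1].
pose X2 := \bigcup_(i in J) \bigcup_(v in S i)
   setX (covering A0 (S i :\ v)) [set v].
have cover : setX G (e b) \subset X0 :|: X1 :|: X2.
  apply/subsetP => -[g v] gv; rewrite 2!in_setU.
  have [//|nX1] := boolP ((g, v) \in X1); first by rewrite orbT.
  have [|nX2] := boolP ((g, v) \in X2); first by rewrite orbT.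
  rewrite !orbF inE gv /=.
  move: (gv); rewrite in_setX /= => /andP[gG ve].
  have vg : v \notin image_of g by move: nX1; rewrite inE gv.
  have [h1 h2 h3 h4] := admissibleP _ _ gG.
  apply/admissibleP; split.
  - move=> a; rewrite ffunE; case: (a =P b) => [->//|/eqP ab].
    by rewrite -h1 !inE ab.
  - by move=> a w; rewrite ffunE; case: eqP => [-> [<-]|_] //; apply: h2.
  - move=> a c; rewrite !ffunE; case: (a =P b) => [->|_]; case: (c =P b) => [->|_] //.
    + by move=> _ gc; case/negP: vg; apply/image_ofP; exists c.
    + by move=> _ gc; case/negP: vg; apply/image_ofP; exists a.
    + exact: h3.
  - move=> i iJ; apply/negP => /subsetP sub.
    have sub' : S i :\ v \subset image_of g.
      apply/subsetP => w; rewrite !inE => /andP[wv /sub] /image_ofP[a].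
      rewrite ffunE; case: (a =P b) => [_ [vw]|_ ga]; first by rewrite vw eqxx in wv.
      by apply/existsP; exists a; rewrite ga.
    have [vS|nvS] := boolP (v \in S i).
      case/negP: nX2; apply/bigcupP; exists i => //; apply/bigcupP; exists v => //.
      by rewrite in_setX set11 inE gG sub'.
    case/negP: (h4 i iJ); apply: subset_trans sub'.
    by apply/subsetP => w wS; rewrite !inE wS andbT; apply: contraNneq nvS => <-.
apply: leq_trans (subset_leq_card cover) _.
apply: leq_trans (leq_card_setU _ _).1 _; apply: leq_add.
  apply: leq_trans (leq_card_setU _ _).1 _; apply: leq_add.
    rewrite -(card_in_imset (f := fun p => assign p.1 b (Some p.2))).
      apply/subset_leq_card/subsetP => _ /imsetP[p + ->].
      by rewrite inE => /andP[].
    move=> [g v] [g' v'] /setIdP[/setXP[gG _] _] /setIdP[/setXP[gG' _] _].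
    have gb g1 : g1 \in G -> g1 b = None.
      by case/admissibleP => h1 _ _ _; move: (h1 b); rewrite !inE eqxx; case: (g1 b).
    move=> /ffunP eqg; congr (_, _); last first.
      by move: (eqg b); rewrite !ffunE eqxx => -[].
    apply/ffunP => a; move: (eqg a); rewrite !ffunE; case: (a =P b) => // -> _.
    by rewrite !gb.
  rewrite mulnC (_ : _ * _ = \sum_(g in G) #|A|)%N; last by rewrite sum_nat_const.
  have sub : X1 \subset \bigcup_(g in G) setX [set g] (image_of g).
    apply/subsetP => -[g v] /setIdP[/setXP[gG _] vg].
    by apply/bigcupP; exists g => //; rewrite in_setX set11.
  apply: leq_trans (subset_leq_card sub) _.
  elim/big_ind2: _ => [|X x Y z le1 le2|g gG]; first by rewrite cards0.
    exact: leq_trans (leq_card_setU _ _).1 (leq_add _ _).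
  rewrite cardsX cards1 mul1n (leq_trans (card_image_of gG)) //.
  by rewrite subset_leq_card // subsetDl.
rewrite /X2; elim/big_ind2: _ => [|X x Y z le1 le2|i iJ]; first by rewrite cards0.
  exact: leq_trans (leq_card_setU _ _).1 (leq_add _ _).
elim/big_ind2: _ => [|X x Y z le1 le2|v vS]; first by rewrite cards0.
  exact: leq_trans (leq_card_setU _ _).1 (leq_add _ _).
by rewrite cardsX cards1 muln1.
Qed.

(** Serving one more demand multiplies the number of admissible choices by at
least [n / 2]. Of the [n] candidate vertices, [budget] bounds by [n / 2] the
average number that are lost. The induction is on the size of [A], so that
[card_covering] is available on [A :\ b]. *)
Lemma admissible_growth A b : A \subset D -> b \in A ->
  n%:R / 2 * #|admissible (A :\ b)|%:R <= #|admissible A|%:R :> R.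
Proof.
elim: {A}_.+1 {-2}A b (ltnSn #|A|) => // k IH A b leA AD bA.
set A0 := A :\ b; set N : R := #|admissible A0|%:R.
have A0D : A0 \subset D by exact: subset_trans (subsetDl _ _) AD.
have hA0 A' b' : A' \subset A0 -> b' \in A' ->
    n%:R / 2 * #|admissible (A' :\ b')|%:R <= #|admissible A'|%:R :> R.
  move=> A'A0; apply: IH; last exact: subset_trans A'A0 A0D.
  apply: leq_ltn_trans (subset_leq_card A'A0) _.
  by move: leA; rewrite (cardsD1 b A) bA.
have step : n%:R * N <= #|admissible A|%:R + #|D|%:R * N
    + (\sum_(i in J) #|S i|%:R * y ^+ #|S i|.-1) * N.
  have := admissible_extend AD bA.
  rewrite -(ler_nat R) !natrD !natrM natr_sum => /le_trans; apply.
  apply: lerD.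
    by rewrite lerD2l ler_wpM2r ?ler0n // ler_nat subset_leq_card.
  rewrite mulr_suml; apply: ler_sum => i iJ.
  apply: le_trans (_ : \sum_(v in S i) y ^+ #|S i|.-1 * N <= _).
    rewrite natr_sum; apply: ler_sum => v vS.
    have -> : #|S i|.-1 = #|S i :\ v| by rewrite (cardsD1 v (S i)) vS.
    exact: card_covering.
  by rewrite sumr_const -[leLHS]mulr_natl mulrA.
have N0 : 0 <= N by rewrite ler0n.
have := ler_wpM2r N0 budget.
by rewrite mulrDl; move: step; set s := (\sum_(i in J) _) => step bud; lra.
Qed.


Lemma admissible_exists : (forall i, i \in J -> S i != set0) ->
  exists g, g \in admissible D.
Proof.
move=> Sn0.
have pos k A : #|A| = k -> A \subset D -> (0 < #|admissible A|)%N.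
  elim: k A => [|k IH] A cA AD.
    apply/card_gt0P; exists [ffun => None]; apply/admissibleP; split.
    - by move=> b; rewrite (cards0_eq cA) inE ffunE.
    - by move=> b v; rewrite ffunE.
    - by move=> a b; rewrite ffunE.
    - move=> i iJ; apply: contra (Sn0 i iJ); rewrite -subset0 => /subset_trans.
      by apply; apply/subsetP => v /image_ofP[b]; rewrite ffunE.
  have [b bA] : exists b, b \in A by apply/card_gt0P; rewrite cA.
  rewrite -(ltr0n R); apply: lt_le_trans (admissible_growth AD bA).
  rewrite mulr_gt0 ?divr_gt0 ?ltr0n //; apply: IH.
    by move: cA; rewrite (cardsD1 b A) bA => -[].
  exact: subset_trans (subsetDl _ _) AD.
by have /card_gt0P[g gD] := pos _ D erefl (subxx _); exists g.
Qed.
End Counting.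

(** * The first coloring *)

(** The vertices are colored independently, so the sum factors over them: a
vertex of [E] contributes [x] for the color [j] and 1 for each of the others,
a vertex outside [E] contributes [r]. *)
Lemma sum_expr_color_class (R : realFieldType) (V : finType) (r : nat) (x : R)
    (E : {set V}) (j : 'I_r) :
  \sum_(f : {ffun V -> 'I_r}) x ^+ #|[set v in E | f v == j]| =
    (r%:R - 1 + x) ^+ #|E| * r%:R ^+ #|~: E|.
Proof.
pose F v (c : 'I_r) : R := if (v \in E) && (c == j) then x else 1.
rewrite (eq_bigr (fun f : {ffun V -> 'I_r} => \prod_v F v (f v))); last first.
  move=> f _; rewrite -big_mkcond /= -prodr_const.
  by apply: eq_bigl => v; rewrite inE.
rewrite -bigA_distr_bigA /= (bigID (mem E)) /=; congr (_ * _).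
  rewrite -prodr_const; apply: eq_bigr => v vE.
  rewrite (bigD1 j) //= /F vE eqxx /= addrC; congr (_ + _).
  rewrite (eq_bigr (fun=> 1)); last by move=> c /negPf ->.
  have := sumr_const (predT : pred 'I_r) (1 : R).
  by rewrite (bigD1 j) //= card_ord => <-; rewrite addrAC subrr add0r.
rewrite -prodr_const; apply: eq_big => v; first by rewrite inE.
move=> /negPf vE; rewrite (eq_bigr (fun=> 1)); last by move=> c _; rewrite /F vE.
by rewrite sumr_const card_ord.
Qed.

(** A coloring that minimizes the potential is at least as good as the average
one. The average is computed by [sum_expr_color_class] and estimated by
[1 + u <= expR u] with [u = (t / n - 1) / r]. *)
Lemma exists_coloring_small_potential (R : realType) (V : finType) (n r : nat)
    (E : {set {set V}}) (t : R) :
  (0 < n)%N -> (0 < r)%N -> (forall e, e \in E -> #|e| = n) -> 0 <= t ->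
  exists f : {ffun V -> 'I_r},
    \sum_(e in E) \sum_(j < r) (t / n%:R) ^+ #|[set v in e | f v == j]|
      <= #|E|%:R * r%:R * expR ((t - n%:R) / r%:R).
Proof.
move=> n_gt0 r_gt0 En t_ge0.
have nR : 0 < n%:R :> R by rewrite ltr0n.
have rR : 0 < r%:R :> R by rewrite ltr0n.
set x : R := t / n%:R.
pose Phi (f : {ffun V -> 'I_r}) : R :=
  \sum_(e in E) \sum_(j < r) x ^+ #|[set v in e | f v == j]|.
set L : R := #|E|%:R * r%:R * _.
have class_le e (j : 'I_r) : e \in E ->
    \sum_(f : {ffun V -> 'I_r}) x ^+ #|[set v in e | f v == j]|
      <= r%:R ^+ #|V| * expR ((t - n%:R) / r%:R).
  move=> eE; rewrite sum_expr_color_class -(cardsC e) exprD (En e eE).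
  rewrite [leRHS]mulrAC ler_wpM2r ?exprn_ge0 ?ler0n //.
  have -> : (t - n%:R) / r%:R = n%:R * ((x - 1) / r%:R).
    by rewrite /x; field; rewrite !gt_eqF.
  rewrite expRM_natl -exprMn lerXn2r ?nnegrE ?mulr_ge0 ?expR_ge0 ?ler0n //.
    by rewrite addr_ge0 ?divr_ge0 ?ler0n // subr_ge0 ler1n.
  apply: le_trans (_ : r%:R * (1 + (x - 1) / r%:R) <= _).
    by rewrite le_eqVlt; apply/orP; left; apply/eqP; field; rewrite gt_eqF.
  by rewrite ler_wpM2l ?ler0n // expR_ge1Dx.
have sum_le : \sum_f Phi f <= r%:R ^+ #|V| * L.
  rewrite exchange_big /=.
  apply: le_trans (_ : \sum_(e in E) r%:R * (r%:R ^+ #|V| *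
      expR ((t - n%:R) / r%:R)) <= _).
    apply: ler_sum => e eE; rewrite exchange_big /=.
    apply: le_trans (_ : \sum_(j < r) (r%:R ^+ #|V| *
      expR ((t - n%:R) / r%:R)) <= _).
      by apply: ler_sum => j _; apply: class_le.
    by rewrite sumr_const card_ord -[leLHS]mulr_natl.
  rewrite sumr_const -[leLHS]mulr_natl /L le_eqVlt; apply/orP; left.
  by apply/eqP; ring.
pose f1 : {ffun V -> 'I_r} := [ffun=> Ordinal r_gt0].
have [f _ fmin] := @arg_minP _ _ _ f1 xpredT Phi isT.
exists f; rewrite -(ler_pM2l (exprn_gt0 #|V| rR)); apply: le_trans sum_le.
apply: le_trans (_ : \sum_(g : {ffun V -> 'I_r}) Phi f <= _).
  by rewrite sumr_const card_ffun card_ord -[leRHS]mulr_natl natrX.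
by apply: ler_sum => g _; apply: fmin.
Qed.

(** * Recoloring *)

(** The demands are the pairs (edge, color) missed by [f], and the forbidden sets
are the nonempty color classes inside edges. Multiplying the potential bound by
[n / r] gives the budget of [admissible_exists] with [y = r / n]. A vertex
chosen for [(e, j)] gets the color [j]; distinctness makes this unambiguous. *)
Lemma recolor_panchromatic (R : realType) (H : hypergraph) (n r : nat)
    (f : {ffun H -> 'I_r}) :
  (0 < r)%N -> (r <= n)%N -> uniform n H ->
  \sum_(e in edges H) \sum_(j < r)
    ((2 * r%:R : R) / n%:R) ^+ #|[set v in e | f v == j]|
      <= r%:R ^+ 2 / (2 * n%:R) ->
  exists g : H -> 'I_r, panchromatic g.
Proof.
move=> r_gt0 r_le_n Hu.
have n_gt0 : (0 < n)%N by exact: leq_trans r_le_n.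
have nR : 0 < n%:R :> R by rewrite ltr0n.
have rR : 0 < r%:R :> R by rewrite ltr0n.
have rnR : r%:R <= n%:R :> R by rewrite ler_nat.
pose S (b : {set H} * 'I_r) := [set v in b.1 | f v == b.2].
pose D := [set b | (b.1 \in edges H) && (S b == set0)].
pose J := [set b | (b.1 \in edges H) && (S b != set0)].
set y : R := r%:R / n%:R.
have y_gt0 : 0 < y by rewrite divr_gt0.
have -> : (2 * r%:R : R) / n%:R = 2 * y by rewrite /y mulrA.
rewrite pair_big_dep /= (bigID (fun b => S b == set0)) /=.
rewrite (eq_bigl (fun b => b \in D)); last by move=> b; rewrite inE andbT.
rewrite [X in _ + X](eq_bigl (fun b => b \in J)); last by move=> b; rewrite inE andbT.
rewrite (eq_bigr (fun=> 1)); last first.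
  by move=> b; rewrite inE => /andP[_ /eqP Sb]; rewrite -/(S b) Sb cards0.
rewrite sumr_const; set W : R := \sum_(b in J) _ => DW.
have W_ge0 : 0 <= W.
  by apply: sumr_ge0 => b _; rewrite exprn_ge0 // mulr_ge0 // ltW.
have scale : y^-1 * (#|D|%:R + W) <= r%:R / 2.
  rewrite mulrC ler_pdivrMr //; apply: le_trans DW _.
  by rewrite /y le_eqVlt; apply/orP; left; apply/eqP; field; rewrite gt_eqF.
have yV : 1 <= y^-1 by rewrite invf_ge1 // /y ler_pdivrMr // mul1r.
have le_D : #|D|%:R <= y * (n%:R / 2).
  have -> : y * (n%:R / 2) = r%:R / 2 by rewrite /y; field; rewrite gt_eqF.
  apply: le_trans scale; rewrite mulrDr.
  apply: ler_wpDr; first by rewrite mulr_ge0 // invr_ge0 ltW.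
  by rewrite ler_peMl.
have card_e b : b \in D -> #|b.1| = n by rewrite inE => /andP[/Hu].
have budget : \sum_(b in J) #|S b|%:R * y ^+ #|S b|.-1 + #|D|%:R <= n%:R / 2.
  apply: le_trans (_ : r%:R / 2 <= _); last by rewrite ler_pM2r ?invr_gt0.
  apply: le_trans scale; rewrite addrC mulrDr; apply: lerD.
    by rewrite ler_peMl.
  rewrite mulr_sumr; apply: ler_sum => b; rewrite inE -card_gt0 => /andP[_].
  (* k y^(k-1) <= y^-1 (2y)^k for k > 0, from k <= 2^k *)
  rewrite -/(S b); case: #|S b| => // k _ /=.
  rewrite [(2 * y) ^+ _]exprMn (exprS y) mulrCA [y^-1 * _]mulrA mulVf ?gt_eqF // mul1r.
  by rewrite ler_wpM2r ?exprn_ge0 ?ltW // -natrX ltr_nat ltn_expl.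
have Sn0 b : b \in J -> S b != set0 by rewrite inE => /andP[].
have [g /admissibleP[g1 g2 g3 g4]] :=
  admissible_exists n_gt0 card_e (ltW y_gt0) le_D budget Sn0.
pose h v := if [pick b | g b == Some v] is Some b then b.2 else f v.
exists h => e eE j.
have [S0|Sn] := boolP (S (e, j) == set0).
  have : (e, j) \in D by rewrite inE eE S0.
  rewrite g1; case gv: (g (e, j)) => [v|] // _.
  exists v; first exact: g2 gv.
  rewrite /h; case: pickP => [b /eqP gb|/(_ (e, j))]; last by rewrite gv eqxx.
  by rewrite (g3 b (e, j)) ?gb ?gv.
have /g4 /subsetPn[v] : (e, j) \in J by rewrite inE eE Sn.
rewrite inE /= => /andP[ve /eqP fv] nv; exists v => //.
rewrite /h; case: pickP => [b /eqP gb|//].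
by case/negP: nv; apply/image_ofP; exists b.
Qed.

Theorem theorem1p4 (R : realType) :
  exists c c' : R, [/\ 0 < c, 0 < c' &
    forall n r : nat, (2 <= r)%N -> (r <= n)%N ->
      Num.sqrt (n%:R : R) <= r%:R ->
      r%:R <= c' * (n%:R / ln n%:R) ->
      c * (r%:R / n%:R) * expR (n%:R / r%:R) <= (p n r)%:R].
Proof.
(* This c turns the bound |E| r e^(2 - n/r) on the least potential into
   r^2 / (2n), which is what the recoloring step can afford. *)
exists (expR (- 2) / 2), 1; split; rewrite ?divr_gt0 ?expR_gt0 ?ltr0n //.
move=> n r r_gt1 r_le_n _ _.
have [H [Hu Hnp cardH]] := p_attained n r_gt1.
rewrite leNgt; apply/negP => small; apply: Hnp.
have r_gt0 : (0 < r)%N by exact: ltnW.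
have n_gt0 : (0 < n)%N by exact: leq_trans r_le_n.
have rR : 0 < r%:R :> R by rewrite ltr0n.
have nR : 0 < n%:R :> R by rewrite ltr0n.
have [f fP] := exists_coloring_small_potential (t := 2 * r%:R : R) n_gt0 r_gt0 Hu
  (mulr_ge0 (ler0n _ 2) (ler0n _ r)).
apply: (recolor_panchromatic r_gt0 r_le_n Hu (f := f)).
apply: le_trans fP _; rewrite cardH.
have -> : (2 * r%:R - n%:R) / r%:R = 2 - n%:R / r%:R :> R by field; rewrite gt_eqF.
set a : R := n%:R / r%:R in small *.
have -> : r%:R ^+ 2 / (2 * n%:R) =
   (expR (- 2) / 2 * (r%:R / n%:R) * expR a) * r%:R * expR (2 - a) :> R.
  rewrite expRD !expRN; field.
  by rewrite !gt_eqF ?expR_gt0.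
rewrite ler_wpM2r ?expR_ge0 // ler_wpM2r ?ler0n //; exact: ltW.
Qed.
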